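(* Let $\mathbf{A}$ be a finite lattice algebra, $\tau$ a finite relational vocabulary, and for each $R\in\tau$ let $p_R\colon A\to[0,1]$ be a probability distribution with $p_R(a)>0$ for all $a\in A$. There is a countable $\mathbf{A}$-valued $\tau$-structure $\mathfrak{R}^{\mathbf{A}}_\tau$ such that for every sentence $\varphi$ of $\mathcal{L}^{\mathbf{A}}(\tau)$ and every $a\in A$: $\lim_{n\to\infty}\mu_n(\varphi=a)=1$ if and only if $\|\varphi\|^{\mathfrak{R}^{\mathbf{A}}_\tau}=a$.
   Context: A lattice algebra is an algebra $\mathbf{A}=\langle A,\wedge,\vee,\dots\rangle$ with a lattice reduct and possibly further finitary operations. For a relational vocabulary $\tau$, formulas of $\mathcal{L}^{\mathbf{A}}(\tau)$ are built from atomic formulas $R(x_1,\dots,x_{\tau(R)})$ using one connective per operation of $\mathbf{A}$ and quantifiers $\forall,\exists$. An $\mathbf{A}$-valued $\tau$-structure $\mathfrak{M}$ has nonempty domain $M$ and maps $R^{\mathfrak{M}}\colon M^{\tau(R)}\to A$; truth values $\|\varphi\|^{\mathfrak{M}}\in A$ are computed with connectives as the operations of $\mathbf{A}$, $\forall$ as infimum and $\exists$ as supremum. With $\mathrm{Mod}^{\mathbf{A}}_{\tau,n}$ the set of such structures with domain $[n]=\{1,\dots,n\}$, $\Pr_n(\mathfrak{M})=\prod\{p_R(R^{\mathfrak{M}}(\bar i)) : R\in\tau,\ \bar i\in[n]^{\tau(R)}\}$, and $\mu_n(\varphi=a)=\sum\{\Pr_n(\mathfrak{M}) : \mathfrak{M}\in\mathrm{Mod}^{\mathbf{A}}_{\tau,n},\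 \|\varphi\|^{\mathfrak{M}}=a\}$.
   Formalization: Every relation symbol in τ is taken to have arity at least 1; with a nullary symbol P and |A| ≥ 2 the claim fails, since μ_n(P = a) = p_P(a) < 1 for every n and every a. *)

(* Defs.v *)
From HB Require Import structures.
From mathcomp Require Import all_boot all_order all_algebra.
From mathcomp Require Import all_classical all_reals all_analysis.

Set Implicit Arguments.
Unset Strict Implicit.
Unset Printing Implicit Defensive.

Import Order.TTheory GRing.Theory Num.Theory.
Import numFieldNormedType.Exports.
Local Open Scope classical_set_scope.
Local Open Scope ring_scope.

(* [finTBLatticeType] is the type of nonempty finite lattices; its top and
   bottom are not operations of the algebra, so they are not connectives unless
   [la_op] provides them. *)
Record finLatticeAlgebra (d : Order.disp_t) := FinLatticeAlgebra {
  la_carrier :> finTBLatticeType d;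
  la_symbol : Type;
  la_arity : la_symbol -> nat;
  la_op : forall o : la_symbol, (la_arity o).-tuple la_carrier -> la_carrier
}.

(* Arities are positive: the truth value of a nullary symbol [r] would be
   distributed as [p_r] for every [n], and no 0-1 law could hold. *)
Record vocabulary := Vocabulary {
  rel_symbol :> finType;
  arity : rel_symbol -> nat;
  arity_gt0 : forall r : rel_symbol, (0 < arity r)%N
}.

Section LatticeValuedLogic.
Variables (d : Order.disp_t) (A : finLatticeAlgebra d) (tau : vocabulary).

(* [formula k] is the type of formulas with free variables among ['I_k]
   (de Bruijn indices): a quantifier binds variable [0] and shifts the others. *)
Inductive formula : nat -> Type :=
| FAtom k (r : tau) of (arity r).-tuple 'I_k : formula k
| FMeet k of formula k & formula k : formula k
| FJoin k of formula k & formula k : formula k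
| FOp k (o : la_symbol A) of ('I_(la_arity o) -> formula k) : formula k
| FForall k of formula k.+1 : formula k
| FExists k of formula k.+1 : formula k.

Definition sentence := formula 0.

Definition interpretation (M : Type) :=
  forall r : tau, (arity r).-tuple M -> A.

Record structure := Structure {
  domain :> Type;
  domain_nonempty : inhabited domain;
  interp : interpretation domain
}.

Definition infimum (M : Type) (f : M -> A) : A :=
  (\meet_(a : A | `[< exists m, f m = a >]) a)%O.

Definition supremum (M : Type) (f : M -> A) : A :=
  (\join_(a : A | `[< exists m, f m = a >]) a)%O.

Lemma infimumP (M : Type) (f : M -> A) (b : A) :
  (b <= infimum f)%O <-> forall m, (b <= f m)%O.
Proof.
split=> [/meetsP h m | h]; first by apply: h; apply/asboolP; exists m.
by apply/meetsP => _ /asboolP[m <-].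
Qed.

Lemma supremumP (M : Type) (f : M -> A) (b : A) :
  (supremum f <= b)%O <-> forall m, (f m <= b)%O.
Proof.
split=> [/joinsP h m | h]; first by apply: h; apply/asboolP; exists m.
by apply/joinsP => _ /asboolP[m <-].
Qed.

Fixpoint eval (M : Type) (I : interpretation M) (k : nat) (phi : formula k) :
    k.-tuple M -> A :=
  match phi in formula k return k.-tuple M -> A with
  | FAtom _ r v => fun e => I r [tuple tnth e (tnth v i) | i < arity r]
  | FMeet _ phi psi => fun e => (eval I phi e `&` eval I psi e)%O
  | FJoin _ phi psi => fun e => (eval I phi e `|` eval I psi e)%O
  | FOp _ o phis => fun e =>
      la_op [tuple eval I (phis i) e | i < la_arity o]
  | FForall _ phi => fun e => infimum (fun m => eval I phi [tuple of m :: e])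
  | FExists _ phi => fun e => supremum (fun m => eval I phi [tuple of m :: e])
  end.

Definition truth_value (M : Type) (I : interpretation M) (phi : sentence) : A :=
  eval I phi [tuple].

(* The structures with domain [[n]], encoded as ['I_n]: the maps
   [R^M : [n]^(arity R) -> A] are gathered into one finite function on the
   pairs [(R, i)].  The type is also defined for [n = 0], which is irrelevant
   for limits as [n] tends to infinity. *)
Definition fin_model (n : nat) :=
  {ffun {r : tau & (arity r).-tuple 'I_n} -> A}.

Definition fin_interp (n : nat) (M : fin_model n) : interpretation 'I_n :=
  fun r i => M (Tagged (fun r : tau => (arity r).-tuple 'I_n) i).

Variable R : realType.

Definition is_distribution (q : A -> R) : Prop :=
  (forall a, 0 <= q a <= 1) /\ \sum_(a : A) q a = 1.

Variable p : tau -> A -> R.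

Definition Pr (n : nat) (M : fin_model n) : R :=
  \prod_(r : tau) \prod_(i : (arity r).-tuple 'I_n) p r (fin_interp M i).

Definition mu (n : nat) (phi : sentence) (a : A) : R :=
  \sum_(M : fin_model n | truth_value (fin_interp M) phi == a) Pr M.

End LatticeValuedLogic.

(* Main.v *)
Require Import Defs.
From HB Require Import structures.
From mathcomp Require Import all_boot all_order all_algebra.
From mathcomp Require Import all_classical all_reals all_analysis.
From mathcomp Require Import ring.

Set Implicit Arguments.
Unset Strict Implicit.
Unset Printing Implicit Defensive.

Import Order.TTheory GRing.Theory Num.Theory.
Import numFieldNormedType.Exports.
Local Open Scope classical_set_scope.
Local Open Scope ring_scope.

(** A structure has the [k]-th extension property when, over any [k] elements,
    every prescription of the atomic values of one new element is realized.
    Two structures with the extension properties satisfy the same sentences, by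
    back-and-forth: the value of a formula is invariant under partial
    isomorphisms.  On a random structure of size [n] the extension property
    fails with probability at most [n^k * const * (1 - c)^(n - k)]: the values
    involving distinct new elements are independent, and each new element
    realizes a given prescription with probability at least [c > 0].  Hence the
    value of a sentence is almost surely its value in any countable structure
    with all the extension properties.  One is obtained on [nat] by letting each
    number code the prescription that it realizes over smaller numbers. *)

(** * Extension properties and back-and-forth *)

Definition position (T : eqType) (k : nat) (e : k.-tuple T) (x : T) :
  option 'I_k := insub (index x e).

Lemma position_notin (T : eqType) (k : nat) (e : k.-tuple T) (x : T) :
  x \notin e -> position e x = None.
Proof.
by move=> xe; rewrite /position insubF// memNindex// size_tuple ltnn.
Qed.

Lemma position_in (T : eqType) (k : nat) (e : k.-tuple T) (x : T) :
  x \in e -> exists2 j, position e x = Some j & tnth e j = x.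
Proof.
move=> xe; have jk : (index x e < k)%N.
  by rewrite -[X in (_ < X)%N](size_tuple e) index_mem.
by exists (Ordinal jk); rewrite /position ?insubT// (tnth_nth x) nth_index.
Qed.

Section ExtensionProperty.
Variables (d : Order.disp_t) (A : finLatticeAlgebra d) (tau : vocabulary).

(* A prescription of the values of the relations on the tuples made of [k]
   given elements and one new element, the latter being denoted by [None]. *)
Definition one_point_type (k : nat) :=
  {ffun {r : tau & (arity r).-tuple (option 'I_k)} -> A}.

Definition prescribed (T : eqType) (k : nat) (e : k.-tuple T)
    (g : one_point_type k) (r : tau) (t : (arity r).-tuple T) : A :=
  g (Tagged (fun r : tau => (arity r).-tuple (option 'I_k))
       (map_tuple (position e) t)).

(** Only tuples through [m] are constrained, since the values over [e] alone are settled before [m]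
    is chosen. *)
Definition extension_property (T : eqType) (I : interpretation A tau T)
    (k : nat) : Prop :=
  forall (e : k.-tuple T) (g : one_point_type k),
  exists2 m, m \notin e &
    forall (r : tau) (t : (arity r).-tuple T),
      m \in t -> {subset t <= m :: e} -> I r t = prescribed e g t.

(** The list is the graph of a partial injection; it may repeat pairs, as two variables may take the
    same value. *)
Definition partial_iso (M N : eqType) (I : interpretation A tau M)
    (J : interpretation A tau N) (s : seq (M * N)) : Prop :=
  {in s &, forall x y, (x.1 == y.1) = (x.2 == y.2)} /\
  forall (r : tau) (u : (arity r).-tuple (M * N)), {subset u <= s} ->
    I r (map_tuple fst u) = J r (map_tuple snd u).

Lemma partial_iso_swap (M N : eqType) (I : interpretation A tau M)
    (J : interpretation A tau N) (s : seq (M * N)) :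
  partial_iso I J s -> partial_iso J I (map (fun z => (z.2, z.1)) s).
Proof.
move=> [s1 s2]; split=> [_ _ /mapP[x xs ->] /mapP[y ys ->] /=|r u us].
  by rewrite s1.
have -> : map_tuple fst u =
    map_tuple snd (map_tuple (fun z : N * M => (z.2, z.1)) u).
  by apply: val_inj; rewrite /= -map_comp.
rewrite -s2; first by congr (I r _); apply: val_inj; rewrite /= -map_comp.
by move=> _ /mapP[x /us/mapP[y ys ->] ->]; case: y ys.
Qed.

Lemma partial_iso_forth (M N : eqType) (I : interpretation A tau M)
    (J : interpretation A tau N) (k : nat) (s : k.-tuple (M * N)) (m : M) :
  extension_property J k -> partial_iso I J s ->
  exists m', partial_iso I J ((m, m') :: s).
Proof.
move=> extJ [s1 s2].
have [/mapP[z zs ->]|ms] := boolP (m \in map fst s).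
  exists z.2; rewrite -surjective_pairing.
  have sub : {subset z :: s <= s} by move=> x; rewrite inE => /predU1P[->|].
  split=> [x y /sub xs /sub ys|r u us]; first exact: s1.
  by apply: s2 => x /us /sub.
pose e := map_tuple fst s; pose e' := map_tuple snd s.
(* The type of [m] over the first components, to be realized over the second ones. *)
pose g : one_point_type k :=
  [ffun x => I (tag x) (map_tuple (oapp (tnth e) m) (tagged x))].
have [m' m'e' m'P] := extJ e' g; exists m'; split=> [x y|r u us].
  rewrite !inE => /predU1P[->|xs] /predU1P[->|ys] /=; rewrite ?eqxx//.
  - apply/eqP/eqP => h; first by rewrite h map_f in ms.
    by rewrite h map_f in m'e'.
  - apply/eqP/eqP => h; first by rewrite -h map_f in ms.
    by rewrite -h map_f in m'e'.
  - exact: s1.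
have [mu|mu] := boolP ((m, m') \in u); last first.
  apply: s2 => x xu; have := us _ xu; rewrite inE => /predU1P[xE|//].
  by rewrite -xE xu in mu.
rewrite m'P.
- rewrite /prescribed ffunE /=; congr (I r _); apply: val_inj => /=.
  rewrite -!map_comp; apply/eq_in_map => x /us.
  rewrite inE => /predU1P[->|xs] /=.
    by rewrite position_notin.
  have [j -> /= jE] := position_in (map_f snd xs : x.2 \in e').
  (* If [s] has repetitions, [j] need not be the place [x] came from; equal second components force
     equal first ones, which is enough. *)
  rewrite tnth_map; rewrite tnth_map in jE; apply/eqP.
  by rewrite eq_sym s1 ?mem_tnth// jE.
- exact: (map_f snd mu).
- move=> _ /mapP[x /us + ->].
  rewrite !inE => /predU1P[->|xs]; first by rewrite eqxx.
  by rewrite (map_f snd xs) orbT.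
Qed.

Lemma partial_iso_back (M N : eqType) (I : interpretation A tau M)
    (J : interpretation A tau N) (k : nat) (s : k.-tuple (M * N)) (m' : N) :
  extension_property I k -> partial_iso I J s ->
  exists m, partial_iso I J ((m, m') :: s).
Proof.
move=> extI /partial_iso_swap sJI.
have [m mP] := @partial_iso_forth N M J I k
  (map_tuple (fun z => (z.2, z.1)) s) m' extI sJI.
exists m; have := partial_iso_swap mP; rewrite /= -map_comp.
by rewrite (@eq_map _ _ _ id) ?map_id// => -[].
Qed.

Lemma infimum_eq (M N : Type) (f : M -> A) (g : N -> A) :
  (forall m, exists m', f m = g m') -> (forall m', exists m, f m = g m') ->
  Defs.infimum f = Defs.infimum g.
Proof.
move=> fg gf; apply: eq_bigl => a; apply: asbool_equiv_eq; split.
  by move=> [m <-]; have [m' ->] := fg m; exists m'.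
by move=> [m' <-]; have [m <-] := gf m'; exists m.
Qed.

Lemma supremum_eq (M N : Type) (f : M -> A) (g : N -> A) :
  (forall m, exists m', f m = g m') -> (forall m', exists m, f m = g m') ->
  Defs.supremum f = Defs.supremum g.
Proof.
move=> fg gf; apply: eq_bigl => a; apply: asbool_equiv_eq; split.
  by move=> [m <-]; have [m' ->] := fg m; exists m'.
by move=> [m' <-]; have [m <-] := gf m'; exists m.
Qed.

(* A strict bound on the number of free variables at the quantifiers of
   [phi], hence on the indices of the extension properties it can use. *)
Fixpoint context_bound (k : nat) (phi : formula A tau k) : nat :=
  match phi with
  | FAtom _ _ _ => 0
  | FMeet _ phi psi => maxn (context_bound phi) (context_bound psi)
  | FJoin _ phi psi => maxn (context_bound phi) (context_bound psi)
  | FOp _ _ phis => \max_i context_bound (phis i)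
  | FForall k phi => maxn k.+1 (context_bound phi)
  | FExists k phi => maxn k.+1 (context_bound phi)
  end%N.

(** Induction on [phi]. At a quantifier, forth and back show that both sides range over the same set
    of values, and infimum and supremum depend on that set only. *)
Lemma eval_partial_iso (M N : eqType) (I : interpretation A tau M)
    (J : interpretation A tau N) (k : nat) (phi : formula A tau k)
    (s : k.-tuple (M * N)) :
  (forall j, (j < context_bound phi)%N -> extension_property I j) ->
  (forall j, (j < context_bound phi)%N -> extension_property J j) ->
  partial_iso I J s ->
  Defs.eval I phi (map_tuple fst s) = Defs.eval J phi (map_tuple snd s).
Proof.
elim: phi s => {k} [k r v|k phi IHphi psi IHpsi|k phi IHphi psi IHpsi
    |k o phis IH|k phi IH|k phi IH] s /= extI extJ iso.
- have := iso.2 r [tuple tnth s (tnth v i) | i < arity r] _.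
  rewrite (_ : map_tuple fst _ =
    [tuple tnth (map_tuple fst s) (tnth v i) | i < arity r]); last first.
    by apply: eq_from_tnth => i; rewrite !tnth_map.
  rewrite (_ : map_tuple snd _ =
    [tuple tnth (map_tuple snd s) (tnth v i) | i < arity r]); last first.
    by apply: eq_from_tnth => i; rewrite !tnth_map.
  by apply=> _ /mapP[i _ ->]; exact: mem_tnth.
- by congr Order.meet; [apply: IHphi|apply: IHpsi] => // j jk;
    [apply: extI|apply: extJ|apply: extI|apply: extJ]; rewrite leq_max jk ?orbT.
- by congr Order.join; [apply: IHphi|apply: IHpsi] => // j jk;
    [apply: extI|apply: extJ|apply: extI|apply: extJ]; rewrite leq_max jk ?orbT.
- congr la_op; apply: eq_from_tnth => i; rewrite !tnth_map tnth_ord_tuple.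
  by apply: IH => // j jk; [apply: extI|apply: extJ];
    apply: leq_trans jk (@leq_bigmax _ (fun i => context_bound (phis i)) i).
- have step m m' : partial_iso I J ((m, m') :: s) ->
    Defs.eval I phi [tuple of m :: map_tuple fst s] =
    Defs.eval J phi [tuple of m' :: map_tuple snd s].
    move=> isomm'; rewrite (_ : [tuple of m :: _] =
      map_tuple fst [tuple of (m, m') :: s]); last exact: val_inj.
    rewrite (_ : [tuple of m' :: _] =
      map_tuple snd [tuple of (m, m') :: s]); last exact: val_inj.
    by apply: IH => // j jk; [apply: extI|apply: extJ]; rewrite leq_max jk orbT.
  apply: infimum_eq => m.
    have [|m' /step] := @partial_iso_forth M N I J k s m _ iso; last by exists m'.
    by apply: extJ; rewrite leq_max ltnSn.
  have [|m' /step] := @partial_iso_back M N I J k s m _ iso; last by exists m'.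
  by apply: extI; rewrite leq_max ltnSn.
- have step m m' : partial_iso I J ((m, m') :: s) ->
    Defs.eval I phi [tuple of m :: map_tuple fst s] =
    Defs.eval J phi [tuple of m' :: map_tuple snd s].
    move=> isomm'; rewrite (_ : [tuple of m :: _] =
      map_tuple fst [tuple of (m, m') :: s]); last exact: val_inj.
    rewrite (_ : [tuple of m' :: _] =
      map_tuple snd [tuple of (m, m') :: s]); last exact: val_inj.
    by apply: IH => // j jk; [apply: extI|apply: extJ]; rewrite leq_max jk orbT.
  apply: supremum_eq => m.
    have [|m' /step] := @partial_iso_forth M N I J k s m _ iso; last by exists m'.
    by apply: extJ; rewrite leq_max ltnSn.
  have [|m' /step] := @partial_iso_back M N I J k s m _ iso; last by exists m'.
  by apply: extI; rewrite leq_max ltnSn.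
Qed.

Lemma truth_value_extension_property (M N : eqType)
    (I : interpretation A tau M) (J : interpretation A tau N)
    (phi : sentence A tau) :
  (forall j, (j < context_bound phi)%N -> extension_property I j) ->
  (forall j, (j < context_bound phi)%N -> extension_property J j) ->
  truth_value I phi = truth_value J phi.
Proof.
move=> extI extJ.
have := eval_partial_iso (s := [tuple] : 0.-tuple (M * N)) extI extJ.
rewrite (_ : map_tuple fst _ = [tuple]); last exact: tuple0.
rewrite (_ : map_tuple snd _ = [tuple]); last exact: tuple0.
(* The empty list is a partial isomorphism: arities are positive, so no tuple has all its entries in
   it. *)
apply; split=> // r u us; exfalso.
have := us _ (mem_tnth (Ordinal (arity_gt0 r)) u).
by rewrite in_nil.
Qed.

(** * A countable structure with all the extension properties *)

(* A natural number codes the type it realizes over smaller numbers; the first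
   component, ignored by the decoding, makes room for arbitrarily large codes. *)
Definition type_code :=
  {k : nat & (nat * k.-tuple nat * one_point_type k)%type}.

(** The largest entry of [t] acts as the new element; [\bot] is an arbitrary value for numbers that
    code nothing. *)
Definition coded_interp : interpretation A tau nat := fun r t =>
  match unpickle (\max_(i <- t) i)%N : option type_code with
  | Some (existT k (_, e, g)) => prescribed e g t
  | None => \bot%O
  end.

Lemma injective_unbounded (f : nat -> nat) (b : nat) :
  injective f -> exists n, (b < f n)%N.
Proof.
move=> f_inj; apply/not_existsP => h.
have : (size (map f (iota 0 b.+2)) <= size (iota 0 b.+1))%N.
  apply: uniq_leq_size; first by rewrite map_inj_uniq ?iota_uniq.
  move=> _ /mapP[n _ ->]; rewrite mem_iota /= add0n ltnS leqNgt.
  by apply/negP/h.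
by rewrite size_map !size_iota ltnn.
Qed.

Lemma coded_interp_extension_property (k : nat) :
  extension_property coded_interp k.
Proof.
move=> e g.
pose code n : type_code := existT _ k (n, e, g).
(* Varying the first component gives infinitely many codes of [(e, g)]; one of them exceeds all
   entries of [e], and is then the maximum of every tuple to be checked. *)
have [|n nP] :=
  @injective_unbounded (fun n => pickle (code n)) (\max_(i <- e) i)%N.
  move=> n1 n2 /(pcan_inj (@pickleK type_code)).
  move/(congr1 (fun c : type_code => (projT2 c).1.1)).
  exact.
have le_e i : i \in e -> (i < pickle (code n))%N.
  by move=> ie; apply: leq_ltn_trans nP; apply: (leq_bigmax_seq (F := id)).
exists (pickle (code n)) => [|r t nt te].
  by apply/negP => /le_e; rewrite ltnn.
rewrite /coded_interp (_ : (\max_(i <- t) i)%N = pickle (code n)) ?pickleK//.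
apply/eqP; rewrite eqn_leq (leq_bigmax_seq (F := id))// andbT.
by apply/bigmax_leqP_seq => i /te; rewrite inE => /predU1P[->//|/le_e/ltnW].
Qed.

End ExtensionProperty.

(** * Union bound and independence in finite product measures *)

Lemma sum_union_bound (R : numDomainType) (T I : finType) (W : T -> R)
    (P : pred T) (Q : I -> pred T) :
  (forall x, 0 <= W x) -> (forall x, P x -> exists i, Q i x) ->
  \sum_(x | P x) W x <= \sum_i \sum_(x | Q i x) W x.
Proof.
move=> W_ge0 PQ; under [leRHS]eq_bigr do rewrite big_mkcond.
rewrite exchange_big big_mkcond; apply: ler_sum => x _.
have rest_ge0 (r : pred I) : 0 <= \sum_(i | r i) (if Q i x then W x else 0).
  by apply: sumr_ge0 => i _; case: ifP.
case: ifPn => [/PQ[i Qix]|_]; last exact: rest_ge0.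
by rewrite (bigD1 i)//= Qix lerDl rest_ge0.
Qed.

Section FiniteProductMeasure.
Variables (R : realType) (X V : finType) (w : X -> V -> R).
Hypothesis w_ge0 : forall x a, 0 <= w x a.
Hypothesis w_sum1 : forall x, \sum_a w x a = 1.

Definition weight (f : {ffun X -> V}) : R := \prod_x w x (f x).

Lemma weight_ge0 f : 0 <= weight f.
Proof. exact: prodr_ge0. Qed.

Variable h : X -> V.

Definition agree (S : {set X}) (f : {ffun X -> V}) : bool :=
  [forall x in S, f x == h x].

Lemma agreeU (S T : {set X}) f : agree (S :|: T) f = agree S f && agree T f.
Proof.
apply/forall_inP/andP => [fST|[/forall_inP fS /forall_inP fT] x].
  by split; apply/forall_inP => x xS; apply: fST; rewrite inE xS ?orbT.
by rewrite inE => /orP[/fS|/fT].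
Qed.

(** By distributivity the sum factors over the coordinates, and each coordinate outside [S]
    contributes total mass [1]. *)
Lemma sum_weight_agree (S : {set X}) :
  \sum_(f | agree S f) weight f = \prod_(x in S) w x (h x).
Proof.
transitivity (\sum_(f in family (fun x => [pred a | (x \in S) ==> (a == h x)]))
    weight f).
  apply: eq_bigl => f; apply/forall_inP/familyP => fS x; rewrite ?inE.
    by apply/implyP; exact: fS.
  by move=> xS; have := fS x; rewrite inE xS.
rewrite -bigA_distr_big_dep [RHS]big_mkcond; apply: eq_bigr => x _ /=.
by case: ifPn => xS /=; rewrite ?big_pred1_eq.
Qed.

(** Independence of events on disjoint blocks of coordinates. The block [S0] makes the induction on
    [T] go through, by absorbing the block on which agreement is subtracted. *)
Lemma sum_weight_agree_avoid (I : eqType) (S : I -> {set X}) (T : seq I)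
    (S0 : {set X}) :
  uniq T -> {in T &, forall i j, i != j -> [disjoint S i & S j]%B} ->
  {in T, forall i, [disjoint S0 & S i]%B} ->
  \sum_(f | agree S0 f && all (fun i => ~~ agree (S i) f) T) weight f =
  (\prod_(x in S0) w x (h x)) * \prod_(i <- T) (1 - \prod_(x in S i) w x (h x)).
Proof.
elim: T S0 => [|i T IH] S0 /=.
  move=> _ _ _; rewrite big_nil mulr1 -sum_weight_agree.
  by apply: eq_bigl => f; rewrite andbT.
move=> /andP[iT uT] disj disj0.
have disjT : {in T &, forall i j, i != j -> [disjoint S i & S j]%B}.
  by move=> j l jT lT; apply: disj; rewrite inE ?jT ?lT orbT.
have disj0T : {in T, forall j, [disjoint S0 & S j]%B}.
  by move=> j jT; apply: disj0; rewrite inE jT orbT.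
(* Agreement on [S i] is the induction hypothesis for [S0 :|: S i]; avoidance is what remains by
   subtraction. *)
have := IH S0 uT disjT disj0T; rewrite (bigID (agree (S i)))/=.
under eq_bigl do rewrite andbAC -agreeU.
rewrite IH//; last first.
  move=> j jT; rewrite finset.disjoints_subset finset.subUset -!finset.disjoints_subset disj0T//=.
  apply: disj; rewrite ?inE ?eqxx ?jT ?orbT//.
  by apply: contraNneq iT => ->.
have -> : \prod_(x in S0 :|: S i) w x (h x) =
    (\prod_(x in S0) w x (h x)) * \prod_(x in S i) w x (h x).
  rewrite -bigU ?disj0 ?inE ?eqxx//=.
  by apply: eq_bigl => x; rewrite !inE.
rewrite big_cons.
under [X in _ + X = _]eq_bigl do rewrite -andbA [all _ _ && _]andbC.
by move=> /(canRL (addKr _)) ->; ring.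
Qed.

End FiniteProductMeasure.

(** * Probability that an extension property fails *)

Section ExtensionProbability.
Variables (d : Order.disp_t) (A : finLatticeAlgebra d) (tau : vocabulary).
Variables (R : realType) (p : tau -> A -> R).
Hypothesis p_distr : forall r : tau, is_distribution (p r).
Hypothesis p_gt0 : forall (r : tau) (a : A), 0 < p r a.

Definition prob (n : nat) (P : fin_model A tau n -> Prop) : R :=
  \sum_(M | `[< P M >]) Pr p M.

Lemma Pr_weight (n : nat) (M : fin_model A tau n) :
  Pr p M = weight (fun x => p (tag x)) M.
Proof.
rewrite /Pr sig_big_dep; apply: eq_bigr => -[r t] _.
by rewrite /fin_interp.
Qed.

Lemma Pr_ge0 (n : nat) (M : fin_model A tau n) : 0 <= Pr p M.
Proof. by rewrite Pr_weight weight_ge0// => x a; exact: ltW. Qed.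

Lemma sum_Pr (n : nat) : \sum_(M : fin_model A tau n) Pr p M = 1.
Proof.
transitivity (\prod_(x : {r : tau & (arity r).-tuple 'I_n})
    \sum_(a : A) p (tag x) a).
  by rewrite bigA_distr_bigA; apply: eq_bigr => M _; rewrite Pr_weight.
rewrite big1// => x _.
by have [_] := p_distr (tag x).
Qed.

Lemma p_lower_bound : exists2 q : R, 0 < q <= 1 & forall r a, q <= p r a.
Proof.
(* Starting the minimum at [1] gives [q <= 1] and covers an empty vocabulary. *)
exists (\big[Order.min/1]_(x : tau * A) p x.1 x.2).
  by rewrite bigmin_le_id andbT lt_bigmin.
by move=> r a; exact: (bigmin_le _ (r, a)).
Qed.

Definition new_coords (n k : nat) (e : k.-tuple 'I_n) (m : 'I_n) :
    {set {r : tau & (arity r).-tuple 'I_n}} :=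
  [set x : {r : tau & (arity r).-tuple 'I_n} |
    (m \in tagged x) && all (mem (m :: e)) (tagged x)].

(** A tuple in the second set has its entries in [m' :: e], so [m] cannot occur in it. *)
Lemma new_coords_disjoint (n k : nat) (e : k.-tuple 'I_n) (m m' : 'I_n) :
  m \notin e -> m != m' -> [disjoint new_coords e m & new_coords e m']%B.
Proof.
move=> me mm'; rewrite finset.disjoints_subset; apply/fintype.subsetP => x.
rewrite !inE => /andP[mx _]; apply/negP => /andP[_ /allP/(_ _ mx)].
by rewrite /= inE (negPf mm') (negPf me).
Qed.

(** Each tuple is determined by positions of its entries in [m :: e], whence a bound that does not
    depend on [n]. *)
Lemma card_new_coords (n k : nat) (e : k.-tuple 'I_n) (m : 'I_n) :
  (#|new_coords e m| <= #|{: {r : tau & (arity r).-tuple 'I_k.+1}}|)%N.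
Proof.
pose f (x : {r : tau & (arity r).-tuple 'I_k.+1}) :=
  Tagged (fun r : tau => (arity r).-tuple 'I_n)
    (map_tuple (tnth [tuple of m :: e]) (tagged x)).
apply: leq_trans (leq_imset_card f _); apply: subset_leq_card.
apply/fintype.subsetP => -[r t]; rewrite inE /= => /andP[_ /allP te].
have pos i : exists j, tnth [tuple of m :: e] j == tnth t i.
  have /te /= := mem_tnth i t.
  by move=> /(@tnthP _ _ [tuple of m :: e])[j ->]; exists j.
apply/imsetP; exists (Tagged (fun r : tau => (arity r).-tuple 'I_k.+1)
  [tuple xchoose (pos i) | i < arity r]) => //.
rewrite /f /=; congr Tagged; apply: eq_from_tnth => i.
by rewrite !tnth_map tnth_ord_tuple; apply/esym/eqP/(xchooseP (pos i)).
Qed.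

Definition unrealized (n k : nat) (e : k.-tuple 'I_n)
    (g : one_point_type A tau k) (M : fin_model A tau n) : bool :=
  all (fun m => ~~ agree (fun x => prescribed e g (tagged x)) (new_coords e m) M)
    (enum [predC e]).

Lemma not_extension_property_unrealized (n k : nat) (M : fin_model A tau n) :
  ~ extension_property (fin_interp M) k ->
  exists eg : k.-tuple 'I_n * one_point_type A tau k, unrealized eg.1 eg.2 M.
Proof.
move=> next; apply/not_existsP => real; apply: next => e g.
have /negP/allPn[m] := real (e, g).
rewrite mem_enum /= negbK => me /forall_inP mP; exists m => // r t mt te.
apply/eqP/(mP (Tagged (fun r : tau => (arity r).-tuple 'I_n) t)).
by rewrite inE mt; apply/allP.
Qed.

Lemma unrealized_bound (k : nat) : exists2 c : R, 0 < c <= 1 &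
  forall (n : nat) (e : k.-tuple 'I_n) (g : one_point_type A tau k),
    \sum_(M | unrealized e g M) Pr p M <= (1 - c) ^+ (n - k).
Proof.
have [q /andP[q0 q1] qP] := p_lower_bound.
(* A given [m] outside [e] realizes [g] with at least this probability: the exponent bounds the
   number of its coordinates, each of which is right with probability at least [q]. *)
exists (q ^+ #|{: {r : tau & (arity r).-tuple 'I_k.+1}}|) => [|n e g].
  by rewrite exprn_gt0//= exprn_ile1// ltW.
set c := q ^+ _.
have c1 : c <= 1 by rewrite exprn_ile1// ltW.
under eq_bigr do rewrite Pr_weight.
pose h (x : {r : tau & (arity r).-tuple 'I_n}) := prescribed e g (tagged x).
have := @sum_weight_agree_avoid R _ _ (fun x => p (tag x)) _ h _
  (new_coords e) (enum [predC e]) finset.set0.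
rewrite big_set0 mul1r => H.
rewrite (eq_bigl (fun M => agree h finset.set0 M &&
   all (fun i => ~~ agree h (new_coords e i) M) (enum [predC e]))); last first.
  move=> M; rewrite /unrealized (_ : agree h finset.set0 M)//.
  by apply/forall_inP => x; rewrite inE.
rewrite H ?enum_uniq//; last 3 first.
- by move=> x; have [] := p_distr (tag x).
- move=> m m'; rewrite !mem_enum => me _; exact: new_coords_disjoint.
- by move=> m _; rewrite finset.disjoints_subset finset.sub0set.
rewrite big_enum /=; apply: (@le_trans _ _ (\prod_(m in [predC e]) (1 - c))).
  apply: ler_prod => m _; apply/andP; split.
    rewrite subr_ge0; apply: prodr_ile1 => x _; rewrite (ltW (p_gt0 _ _))/=.
    by have [/(_ (h x))/andP[]] := p_distr (tag x).
  rewrite lerD2l lerN2; apply: (@le_trans _ _ (\prod_(x in new_coords e m) q)).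
    rewrite prodr_const /c ler_wiXn2l// ?ltW//; exact: card_new_coords.
  by apply: ler_prod => x _; rewrite (ltW q0) qP.
(* At least [n - k] candidates lie outside [e], more if [e] has repetitions. *)
rewrite prodr_const ler_wiXn2l ?subr_ge0 ?gerBl//; last first.
  rewrite leq_subLR -[X in (X <= _)%N]card_ord -(cardC (mem e)) leq_add2r.
  by rewrite -[X in (_ <= X)%N](size_tuple e) card_size.
by rewrite ltW// exprn_gt0.
Qed.

(** For [x = c * n.+1], [expR x] dominates the term of degree [k.+1] of its series, whose extra
    factor [n.+1] gives the decay; passing from [n] to [n.+1] costs the factor [expR c]. *)
Lemma exprn_expRN_harmonic (k : nat) (c : R) : 0 < c -> exists2 C : R, 0 <= C &
  forall n, n%:R ^+ k * expR (- (c * n%:R)) <= C * n.+1%:R^-1.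
Proof.
move=> c0; pose D : R := (k.+1)`!%:R / c ^+ k.+1.
have D0 : 0 <= D by rewrite divr_ge0 ?exprn_ge0 ?ltW.
exists (expR c * D) => [|n]; first by rewrite mulr_ge0 ?expR_ge0.
have -> : - (c * n%:R) = c - c * n.+1%:R :> R by rewrite -natr1; ring.
rewrite expRD mulrCA -mulrA ler_pM2l ?expR_gt0// expRN.
have n0 : 0 < n.+1%:R :> R by [].
rewrite ler_pdivrMr ?expR_gt0// mulrAC ler_pdivlMr//.
apply: (@le_trans _ _ (n.+1%:R ^+ k.+1)).
  by rewrite exprSr ler_pM2r// lerXn2r ?nnegrE// ler_nat.
have fact0 : 0 < (k.+1)`!%:R :> R by rewrite ltr0n fact_gt0.
rewrite /D mulrAC ler_pdivlMr ?exprn_gt0// -exprMn -ler_pdivrMl//.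
rewrite mulrC [n.+1%:R * c]mulrC.
apply: le_trans (expR_ge1Dxn k (ltW (mulr_gt0 c0 n0))).
by rewrite lerDr.
Qed.

Lemma prob_not_extension_property (k : nat) : exists2 C : R, 0 <= C &
  forall n, prob (fun M : fin_model A tau n =>
    ~ extension_property (fin_interp M) k) <= C * n.+1%:R^-1.
Proof.
have [c /andP[c0 c1] cP] := unrealized_bound k.
have [C C0 CP] := exprn_expRN_harmonic k c0.
pose G : R := #|{: one_point_type A tau k}|%:R.
(* The union bound runs over [n ^ k * G] pairs [(e, g)]; after [1 - c <= expR (- c)], the factor
   [expR (c * k)] pays for replacing the exponent [n - k] by [n]. *)
exists (G * expR (c * k%:R) * C) => [|n]; first by rewrite !mulr_ge0 ?expR_ge0.
pose Q (eg : k.-tuple 'I_n * one_point_type A tau k) := unrealized eg.1 eg.2.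
apply: (le_trans (@sum_union_bound _ _ _ _ _ Q _ _)).
- exact: Pr_ge0.
- by move=> M /asboolP; exact: not_extension_property_unrealized.
apply: (@le_trans _ _ (\sum_(eg : k.-tuple 'I_n * one_point_type A tau k)
    (1 - c) ^+ (n - k))).
  by apply: ler_sum => -[e g] _; exact: cP.
rewrite sumr_const card_prod card_tuple card_ord -[leLHS]mulr_natl natrM natrX.
apply: (@le_trans _ _ (n%:R ^+ k * G * (expR (c * k%:R) * expR (- (c * n%:R))))).
  rewrite ler_wpM2l ?mulr_ge0 ?exprn_ge0//.
  apply: (@le_trans _ _ (expR (- c) ^+ (n - k))).
    by rewrite lerXn2r ?nnegrE ?expR_ge0 ?subr_ge0// expR_ge1Dx.
  rewrite -expRM_natr -expRD ler_expR mulNr -mulrBr lerNl -mulrN opprB.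
  rewrite ler_wpM2l ?(ltW c0)// lerBlDr -natrD ler_nat addnC.
  by rewrite -leq_subLR.
by rewrite -!mulrA mulrCA ler_wpM2l// mulrCA ler_wpM2l ?expR_ge0.
Qed.

Lemma prob_not_extension_properties (K : nat) : exists2 C : R, 0 <= C &
  forall n, prob (fun M : fin_model A tau n =>
    ~ forall j, (j < K)%N -> extension_property (fin_interp M) j)
    <= C * n.+1%:R^-1.
Proof.
elim: K => [|K [C C0 IH]].
  exists 0 => // n; rewrite mul0r /prob big_pred0// => M.
  by apply/asboolP => -[].
have [C' C'0 C'P] := prob_not_extension_property K.
exists (C + C') => [|n]; first exact: addr_ge0.
rewrite mulrDl; apply: le_trans (lerD (IH n) (C'P n)).
pose Q (b : bool) (M : fin_model A tau n) := if b
  then `[< ~ forall j, (j < K)%N -> extension_property (fin_interp M) j >]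
  else `[< ~ extension_property (fin_interp M) K >].
apply: (le_trans (@sum_union_bound _ _ _ _ _ Q _ _)).
- exact: Pr_ge0.
- move=> M /asboolP next; apply/not_existsP => nQ.
  have /negP/asboolPn/contrapT e1 := nQ true.
  have /negP/asboolPn/contrapT e2 := nQ false.
  apply: next => j; rewrite ltnS leq_eqVlt => /predU1P[->//|]; exact: e1.
by rewrite big_bool.
Qed.

(** * Limits of the probabilities of truth values *)

Lemma mu_lower_bound (phi : sentence A tau) : exists C : R, forall n,
  1 - C * n.+1%:R^-1 <= mu p n phi (truth_value (@coded_interp d A tau) phi).
Proof.
have [C _ CP] := prob_not_extension_properties (context_bound phi).
exists C => n; rewrite lerBlDr -[leLHS](sum_Pr n).
rewrite (bigID (fun M => truth_value (fin_interp M) phi ==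
  truth_value (@coded_interp d A tau) phi)) /= lerD2l.
apply: le_trans (CP n); rewrite /prob big_mkcond [leRHS]big_mkcond.
apply: ler_sum => M _; case: ifPn => [tv|_]; last first.
  by case: ifP => // _; exact: Pr_ge0.
(* A model with the extension properties below [context_bound phi] gives [phi] its value in
   [coded_interp], so any other value puts the model in the failure event. *)
rewrite ifT//; apply/asboolP => ext; move/eqP: tv; apply.
apply: truth_value_extension_property => // j _.
exact: coded_interp_extension_property.
Qed.

Lemma mu_add_le1 (n : nat) (phi : sentence A tau) (a b : A) : a != b ->
  mu p n phi a + mu p n phi b <= 1.
Proof.
move=> ab; rewrite -(sum_Pr n) /mu [in leRHS](bigID
  (fun M => truth_value (fin_interp M) phi == a)) /= lerD2l.
rewrite big_mkcond [leRHS]big_mkcond; apply: ler_sum => M _.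
case: eqP => [->|_]; first by rewrite eq_sym ab.
by case: ifP => // _; exact: Pr_ge0.
Qed.

Lemma mu_le1 (n : nat) (phi : sentence A tau) (a : A) : mu p n phi a <= 1.
Proof.
rewrite -(sum_Pr n) /mu big_mkcond; apply: ler_sum => M _.
by case: ifP => // _; exact: Pr_ge0.
Qed.

Lemma mu_cvg1 (phi : sentence A tau) :
  mu p n phi (truth_value (@coded_interp d A tau) phi) @[n --> \oo] --> (1 : R).
Proof.
have [C CP] := mu_lower_bound phi.
apply: (@squeeze_cvgr _ _ _ _ (fun n => 1 - C * harmonic n) (fun=> 1)).
- by apply: nearW => n; rewrite CP mu_le1.
- rewrite -[X in _ --> X]subr0; apply: cvgB; first exact: cvg_cst.
  rewrite -[X in _ --> X](mulr0 C); apply: cvgM; first exact: cvg_cst.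
  exact: cvg_harmonic.
- exact: cvg_cst.
Qed.

End ExtensionProbability.

Theorem theorem3p5 (d : Order.disp_t) (A : finLatticeAlgebra d)
    (tau : vocabulary) (R : realType) (p : tau -> A -> R)
    (p_distr : forall r : tau, is_distribution (p r))
    (p_gt0 : forall (r : tau) (a : A), 0 < p r a) :
  exists S : structure A tau, countable [set: S] /\
    forall (phi : sentence A tau) (a : A),
      (mu p n phi a @[n --> \oo] --> (1 : R)) <->
      truth_value (@interp d A tau S) phi = a.
Proof.
exists (Structure (inhabits 0%N) (@coded_interp d A tau)).
split=> [|phi a]; first exact: countableP.
have mub := mu_cvg1 p_distr p_gt0 phi; split=> [mua|<-//]; apply/eqP.
apply: contraT => ba.
(* Distinct values are disjoint events, so their probabilities cannot both tend to [1]. *)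
have : (1 + 1 : R) <= 1.
  apply: (cvgr_to_le (cvgD mub mua)); apply: nearW => n /=.
  exact: mu_add_le1.
by rewrite gerDl ler10.
Qed.
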